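(* Let $\Theta\vdash P::\Gamma$ be derivable in CHOP. Then there exists a chop-free process $Q$ such that $\Theta\vdash Q::\Gamma$ is derivable.
   Context: CHOP (Classical Higher-Order Processes). Channel names $x,y,z,\dots$; process variables $p,q,r$; parameter labels $l$ (constants); type variables $X$. A parameter record $\rho=\{l_1=x_1,\dots,l_k=x_k\}$ maps distinct labels to channel names. Processes: $P,Q,R ::= x[y].(P\mid Q)\mid x(y).P\mid x[\mathsf{inl}].P\mid x[\mathsf{inr}].P\mid x.\mathsf{case}(P,Q)\mid ?x[y].P\mid !x(y).P\mid x[A].P\mid x(X).P\mid x[\lambda\rho.P]$ (send the abstraction $\lambda\rho.P$, which binds the names in the image of $\rho$; that image must be exactly the free channel names of $P$) $\mid x(p).P$ (receive an abstraction into $p$, bound in $P$) $\mid p\langle\rho\rangle$ (run) $\mid x[\,]\mid x().P\mid x.\mathsf{case}()\mid x\leftrightarrow^A y$ (link) $\mid(\nu x^A y)(P\mid Q)$ (parallel composition, $x$ bound in $P$, $y$ in $Q$) $\mid \mathsf{let}\ p=\lambda\rho.Q\ \mathsf{in}\ P$ (explicit substitution, $p$ bound in $P$). In $x[y].(P\mid Q)$, $x(y).P$, $?x[y].P$, $!x(y).P$ the name $y$ is bound in the continuation $P$; in $x(X).P$, $X$ is bound. Processes are up to $\alpha$-equivalence. Session types: $A,B::=A\otimes B\mid A⅋B\mid A\oplus B\mid A\&B\mid 0\mid\top\mid1\mid\bot\mid ?A\mid !A\mid\exists X.A\mid\forall X.A\mid X\mid X^\perp\mid\mathsf{send}(\Gamma)\mid\mathsf{recv}(\Gamma)$,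 where a process type $\Gamma=s_1:A_1,\dots,s_n:A_n$ maps distinct keys (all labels or all channels) to session types, order irrelevant; $\Gamma,\Delta$ is the union of disjoint $\Gamma,\Delta$. Duality $A^\perp$: $(X)^\perp=X^\perp$, $(X^\perp)^\perp=X$, $\otimes/⅋$, $\oplus/\&$, $0/\top$, $1/\bot$, $?/!$, $\exists/\forall$ are swapped componentwise ($(A\otimes B)^\perp=A^\perp⅋B^\perp$, $(?A)^\perp=!(A^\perp)$, $(\exists X.A)^\perp=\forall X.A^\perp$, etc.), and $\mathsf{send}(\Gamma)^\perp=\mathsf{recv}(\Gamma)$, $\mathsf{recv}(\Gamma)^\perp=\mathsf{send}(\Gamma)$. $\Gamma\rho$ is $\Gamma$ with each label $l$ replaced by $\rho(l)$; $?\Gamma$ means every type in $\Gamma$ has the form $?A$. A process environment $\Theta=p_1:\Gamma_1,\dots,p_n:\Gamma_n$ has distinct variables; $\cdot$ is empty. Typing rules for $\Theta\vdash P::\Gamma$: (Axiom) $\cdot\vdash x\leftrightarrow^A y::x:A^\perp,y:A$. (Cut) $\Theta\vdash P::\Gamma,x:A$ and $\Theta'\vdash Q::\Delta,y:A^\perp$ give $\Theta,\Theta'\vdash(\nu x^Ay)(P\mid Q)::\Gamma,\Delta$. ($\otimes$) $\Theta\vdash P::\Gamma,y:A$ and $\Theta'\vdash Q::\Delta,x:B$ give $\Theta,\Theta'\vdash x[y].(P\mid Q)::\Gamma,\Delta,x:A\otimes B$. ($⅋$) $\Theta\vdash P::\Gamma,y:A,x:B$ gives $\Theta\vdash x(y).P::\Gamma,x:A⅋B$.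 ($\oplus_1$,$\oplus_2$) $\Theta\vdash P::\Gamma,x:A$ (resp. $x:B$) gives $\Theta\vdash x[\mathsf{inl}].P$ (resp. $x[\mathsf{inr}].P$) $::\Gamma,x:A\oplus B$. ($\&$) $\Theta\vdash P::\Gamma,x:A$ and $\Theta\vdash Q::\Gamma,x:B$ give $\Theta\vdash x.\mathsf{case}(P,Q)::\Gamma,x:A\&B$. ($?$) $\Theta\vdash P::\Gamma,y:A$ gives $\Theta\vdash ?x[y].P::\Gamma,x:?A$. ($!$) $\cdot\vdash P::?\Gamma,y:A$ gives $\cdot\vdash !x(y).P::?\Gamma,x:!A$. ($\exists$) $\Theta\vdash P::\Gamma,x:B\{A/X\}$ gives $\Theta\vdash x[A].P::\Gamma,x:\exists X.B$. ($\forall$) $\Theta\vdash P::\Gamma,x:B$, $X$ not free in $\Theta,\Gamma$, gives $\Theta\vdash x(X).P::\Gamma,x:\forall X.B$. (Weaken) $\Theta\vdash P::\Gamma$ gives $\Theta\vdash P::\Gamma,x:?A$. (Contract) $\Theta\vdash P::\Gamma,y:?A,z:?A$ gives $\Theta\vdash P\{x/y,x/z\}::\Gamma,x:?A$. ($1$) $\cdot\vdash x[\,]::x:1$. ($\bot$) $\Theta\vdash P::\Gamma$ gives $\Theta\vdash x().P::\Gamma,x:\bot$. ($\top$) $\Theta\vdash x.\mathsf{case}()::\Gamma,x:\top$. (No rule for $0$.) (Id) $p:\Gamma\vdash p\langle\rho\rangle::\Gamma\rho$. (Chop) $\Theta\vdash P::\Delta\rho$ and $\Theta',p:\Delta\vdash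 Q::\Gamma$ give $\Theta,\Theta'\vdash\mathsf{let}\ p=\lambda\rho.P\ \mathsf{in}\ Q::\Gamma$. ($\mathsf{send}$) $\Theta\vdash P::\Gamma\rho$ gives $\Theta\vdash x[\lambda\rho.P]::x:\mathsf{send}(\Gamma)$. ($\mathsf{recv}$) $\Theta,p:\Delta\vdash P::\Gamma$ gives $\Theta\vdash x(p).P::\Gamma,x:\mathsf{recv}(\Delta)$. A process is chop-free if its typing derivation contains no application of rule Chop. *)

(* Defs.v *)
From mathcomp Require Import all_boot finmap.

Set Implicit Arguments.
Unset Strict Implicit.
Unset Printing Implicit Defensive.

Local Open Scope fset_scope.
Local Open Scope fmap_scope.

Definition chan := nat.
Definition pvar := nat.
Definition label := nat.

(** * Session types *)

Definition map_fmap (K : choiceType) (V W : Type) (h : V -> W)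
    (f : {fmap K -> V}) : {fmap K -> W} :=
  [fmap k : domf f => h (f k)].

(* Type variables are de Bruijn indices: [Ex] and [All] bind index 0, so that
   alpha-equivalent types are equal.  [DVar n] is the dual variable X^perp.
   Process types below [SendT] and [RecvT] are keyed by labels. *)
Inductive ty : Type :=
| Tensor of ty & ty
| Par of ty & ty
| Plus of ty & ty
| With of ty & ty
| Zero
| Top
| One
| Bot
| WhyNot of ty
| OfCourse of ty
| Ex of ty
| All of ty
| Var of nat
| DVar of nat
| SendT of {fmap label -> ty}
| RecvT of {fmap label -> ty}.

Fixpoint dual (A : ty) : ty :=
  match A with
  | Tensor A B => Par (dual A) (dual B)
  | Par A B => Tensor (dual A) (dual B)
  | Plus A B => With (dual A) (dual B)
  | With A B => Plus (dual A) (dual B)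
  | Zero => Top
  | Top => Zero
  | One => Bot
  | Bot => One
  | WhyNot A => OfCourse (dual A)
  | OfCourse A => WhyNot (dual A)
  | Ex A => All (dual A)
  | All A => Ex (dual A)
  | Var n => DVar n
  | DVar n => Var n
  | SendT G => RecvT G
  | RecvT G => SendT G
  end.

Definition up_ren (f : nat -> nat) (n : nat) : nat :=
  if n is m.+1 then (f m).+1 else 0.

Fixpoint ren_ty (f : nat -> nat) (A : ty) : ty :=
  match A with
  | Tensor A B => Tensor (ren_ty f A) (ren_ty f B)
  | Par A B => Par (ren_ty f A) (ren_ty f B)
  | Plus A B => Plus (ren_ty f A) (ren_ty f B)
  | With A B => With (ren_ty f A) (ren_ty f B)
  | Zero => Zero
  | Top => Top
  | One => One
  | Bot => Bot
  | WhyNot A => WhyNot (ren_ty f A)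
  | OfCourse A => OfCourse (ren_ty f A)
  | Ex A => Ex (ren_ty (up_ren f) A)
  | All A => All (ren_ty (up_ren f) A)
  | Var n => Var (f n)
  | DVar n => DVar (f n)
  | SendT G => SendT (map_fmap (ren_ty f) G)
  | RecvT G => RecvT (map_fmap (ren_ty f) G)
  end.

Definition shift_ty : ty -> ty := ren_ty S.

Definition up_subst (s : nat -> ty) (n : nat) : ty :=
  if n is m.+1 then shift_ty (s m) else Var 0.

Fixpoint subst_ty (s : nat -> ty) (A : ty) : ty :=
  match A with
  | Tensor A B => Tensor (subst_ty s A) (subst_ty s B)
  | Par A B => Par (subst_ty s A) (subst_ty s B)
  | Plus A B => Plus (subst_ty s A) (subst_ty s B)
  | With A B => With (subst_ty s A) (subst_ty s B)
  | Zero => Zero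
  | Top => Top
  | One => One
  | Bot => Bot
  | WhyNot A => WhyNot (subst_ty s A)
  | OfCourse A => OfCourse (subst_ty s A)
  | Ex A => Ex (subst_ty (up_subst s) A)
  | All A => All (subst_ty (up_subst s) A)
  | Var n => s n
  | DVar n => dual (s n)
  | SendT G => SendT (map_fmap (subst_ty s) G)
  | RecvT G => RecvT (map_fmap (subst_ty s) G)
  end.

(* B{A/X}, where X is the variable bound by [Ex B] *)
Definition inst_ty (B A : ty) : ty :=
  subst_ty (fun n => if n is m.+1 then Var m else A) B.

(** * Process types and environments *)

Definition ptype := {fmap label -> ty}.
Definition ctx := {fmap chan -> ty}.
Definition penv := {fmap pvar -> ptype}.
Definition record := {fmap label -> chan}.

Definition shift_ctx : ctx -> ctx := map_fmap shift_ty.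
Definition shift_penv : penv -> penv := map_fmap (map_fmap shift_ty).

(* [renamed G r D] says that D is G r.  The labels of G are exactly those of r,
   and r must be injective since the keys of G r are distinct. *)
Definition renamed (G : ptype) (r : record) (D : ctx) : Prop :=
  [/\ domf G = domf r,
      forall l l' x, r.[? l] = Some x -> r.[? l'] = Some x -> l = l',
      domf D = codomf r
    & forall l x, r.[? l] = Some x -> D.[? x] = G.[? l]].

Definition all_whynot (G : ctx) : Prop :=
  forall x A, G.[? x] = Some A -> exists B, A = WhyNot B.

(** * Processes *)

(* Processes are locally nameless, so that alpha-equivalent processes are equal.
   In [CBound i s], i is the number of channel binders between the occurrence
   and its own binder.  A binder of a single name uses the slot s = None; an
   abstraction over r binds all names of r at once, using slot [Some l] for the
   name r(l). *)
Inductive cref : Type :=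
| CFree of chan
| CBound of nat & option label.

Inductive vref : Type :=
| VFree of pvar
| VBound of nat.

(* Type variables are de Bruijn indices bound by [RInT].  In [RSend x L P], the
   abstraction sent is over a record with set of labels L and body P; in
   [RLet L Q P] its body is Q. *)
Inductive proc : Type :=
| ROut of cref & proc & proc
| RIn of cref & proc
| RInl of cref & proc
| RInr of cref & proc
| RCase of cref & proc & proc
| RReq of cref & proc
| RSrv of cref & proc
| ROutT of cref & ty & proc
| RInT of cref & proc
| RSend of cref & {fset label} & proc
| RRecv of cref & proc
| RRun of vref & {fmap label -> cref}
| RClose of cref
| RWait of cref & proc
| REmpty of cref
| RLink of ty & cref & cref
| RCut of ty & proc & proc
| RLet of {fset label} & proc & proc.

(* Apply fc and fv to all references, passing them the numbers of channel and
   process variable binders that have been crossed. *)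
Fixpoint traverse (fc : nat -> cref -> cref) (fv : nat -> vref -> vref)
    (i j : nat) (P : proc) : proc :=
  let t := traverse fc fv in
  match P with
  | ROut x P Q => ROut (fc i x) (t i.+1 j P) (t i j Q)
  | RIn x P => RIn (fc i x) (t i.+1 j P)
  | RInl x P => RInl (fc i x) (t i j P)
  | RInr x P => RInr (fc i x) (t i j P)
  | RCase x P Q => RCase (fc i x) (t i j P) (t i j Q)
  | RReq x P => RReq (fc i x) (t i.+1 j P)
  | RSrv x P => RSrv (fc i x) (t i.+1 j P)
  | ROutT x A P => ROutT (fc i x) A (t i j P)
  | RInT x P => RInT (fc i x) (t i j P)
  | RSend x L P => RSend (fc i x) L (t i.+1 j P)
  | RRecv x P => RRecv (fc i x) (t i j.+1 P)
  | RRun p r => RRun (fv j p) (map_fmap (fc i) r)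
  | RClose x => RClose (fc i x)
  | RWait x P => RWait (fc i x) (t i j P)
  | REmpty x => REmpty (fc i x)
  | RLink A x y => RLink A (fc i x) (fc i y)
  | RCut A P Q => RCut A (t i.+1 j P) (t i.+1 j Q)
  | RLet L Q P => RLet L (t i.+1 j Q) (t i j.+1 P)
  end.

(* Bind the free channel names in the domain of b, each to the slot b gives. *)
Definition close_chan (b : chan -> option (option label)) : proc -> proc :=
  traverse (fun i c => if c is CFree x then
                         if b x is Some s then CBound i s else c
                       else c)
           (fun _ v => v) 0 0.

Definition close1 (y : chan) : proc -> proc :=
  close_chan (fun x => if x == y then Some None else None).

Definition close_record (r : record) : proc -> proc :=
  close_chan (fun x => omap (fun l : domf r => Some (val l))
                            [pick l : domf r | r l == x]).

Definition close_pvar (p : pvar) : proc -> proc :=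
  traverse (fun _ c => c)
           (fun j v => if v is VFree q then if q == p then VBound j else v
                       else v) 0 0.

(* Simultaneous substitution of free channel names; it is capture-avoiding
   because bound names are indices. *)
Definition rename_chan (f : chan -> chan) : proc -> proc :=
  traverse (fun _ c => if c is CFree x then CFree (f x) else c)
           (fun _ v => v) 0 0.

Definition fn_cref (c : cref) : {fset chan} :=
  if c is CFree x then [fset x] else fset0.

Fixpoint fn (P : proc) : {fset chan} :=
  match P with
  | ROut x P Q => fn_cref x `|` fn P `|` fn Q
  | RIn x P => fn_cref x `|` fn P
  | RInl x P => fn_cref x `|` fn P
  | RInr x P => fn_cref x `|` fn P
  | RCase x P Q => fn_cref x `|` fn P `|` fn Q
  | RReq x P => fn_cref x `|` fn P
  | RSrv x P => fn_cref x `|` fn P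
  | ROutT x _ P => fn_cref x `|` fn P
  | RInT x P => fn_cref x `|` fn P
  | RSend x _ P => fn_cref x `|` fn P
  | RRecv x P => fn_cref x `|` fn P
  | RRun _ r => \big[fsetU/fset0]_(l : domf r) fn_cref (r l)
  | RClose x => fn_cref x
  | RWait x P => fn_cref x `|` fn P
  | REmpty x => fn_cref x
  | RLink _ x y => fn_cref x `|` fn_cref y
  | RCut _ P Q => fn P `|` fn Q
  | RLet _ Q P => fn Q `|` fn P
  end.

(* Named syntax *)

(* x[y].(P | Q) *)
Definition out (x y : chan) (P Q : proc) := ROut (CFree x) (close1 y P) Q.
(* x(y).P *)
Definition inp (x y : chan) (P : proc) := RIn (CFree x) (close1 y P).
(* x[inl].P *)
Definition sel_l (x : chan) (P : proc) := RInl (CFree x) P.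
(* x[inr].P *)
Definition sel_r (x : chan) (P : proc) := RInr (CFree x) P.
(* x.case(P, Q) *)
Definition case2 (x : chan) (P Q : proc) := RCase (CFree x) P Q.
(* ?x[y].P *)
Definition req (x y : chan) (P : proc) := RReq (CFree x) (close1 y P).
(* !x(y).P *)
Definition srv (x y : chan) (P : proc) := RSrv (CFree x) (close1 y P).
(* x[A].P *)
Definition outT (x : chan) (A : ty) (P : proc) := ROutT (CFree x) A P.
(* x(X).P, where X is index 0 in P *)
Definition inT (x : chan) (P : proc) := RInT (CFree x) P.
(* x[\r.P] *)
Definition send (x : chan) (r : record) (P : proc) :=
  RSend (CFree x) (domf r) (close_record r P).
(* x(p).P *)
Definition recv (x : chan) (p : pvar) (P : proc) :=
  RRecv (CFree x) (close_pvar p P).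
(* p<r> *)
Definition run (p : pvar) (r : record) := RRun (VFree p) (map_fmap CFree r).
(* x[] *)
Definition close0 (x : chan) := RClose (CFree x).
(* x().P *)
Definition wait (x : chan) (P : proc) := RWait (CFree x) P.
(* x.case() *)
Definition case0 (x : chan) := REmpty (CFree x).
(* x <->^A y *)
Definition link (x : chan) (A : ty) (y : chan) := RLink A (CFree x) (CFree y).
(* (nu x^A y)(P | Q) *)
Definition par (x : chan) (A : ty) (y : chan) (P Q : proc) :=
  RCut A (close1 x P) (close1 y Q).
(* let p = \r.Q in P *)
Definition letin (p : pvar) (r : record) (Q P : proc) :=
  RLet (domf r) (close_record r Q) (close_pvar p P).

(** * Typing *)

Implicit Types (Th : penv) (P Q : proc) (x y z : chan) (p : pvar).
Implicit Types (A B : ty) (r : record).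

Definition disj (K : choiceType) (V : Type) (f g : {fmap K -> V}) : bool :=
  fdisjoint (domf f) (domf g).

(* [typing Th P G] is the type of derivations of Th |- P :: G.  The comma of the
   rules is [_.[_ <- _]] or [+], with freshness and disjointness as
   explicit premises.  "X not free in Th, G" is expressed by the shifts in
   [t_all].  The premises on [fn P] in [t_chop] and [t_send] are the
   well-formedness condition of the abstraction. *)
Inductive typing : penv -> proc -> ctx -> Type :=
| t_axiom x y A of x != y :
    typing [fmap] (link x A y) [fmap].[x <- dual A].[y <- A]
| t_cut Th Th' P Q (G D : ctx) x y A of
    typing Th P G.[x <- A] & typing Th' Q D.[y <- dual A] &
    x \notin domf G & y \notin domf D & disj Th Th' & disj G D :
    typing (Th + Th') (par x A y P Q) (G + D)
| t_tensor Th Th' P Q (G D : ctx) x y A B of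
    typing Th P G.[y <- A] & typing Th' Q D.[x <- B] &
    y \notin domf G & x \notin domf G & x \notin domf D & disj Th Th' &
    disj G D :
    typing (Th + Th') (out x y P Q) (G + D).[x <- Tensor A B]
| t_par Th P (G : ctx) x y A B of
    typing Th P G.[y <- A].[x <- B] &
    y \notin domf G & x \notin domf G & x != y :
    typing Th (inp x y P) G.[x <- Par A B]
| t_plus1 Th P (G : ctx) x A B of
    typing Th P G.[x <- A] & x \notin domf G :
    typing Th (sel_l x P) G.[x <- Plus A B]
| t_plus2 Th P (G : ctx) x A B of
    typing Th P G.[x <- B] & x \notin domf G :
    typing Th (sel_r x P) G.[x <- Plus A B]
| t_with Th P Q (G : ctx) x A B of
    typing Th P G.[x <- A] & typing Th Q G.[x <- B] & x \notin domf G :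
    typing Th (case2 x P Q) G.[x <- With A B]
| t_whynot Th P (G : ctx) x y A of
    typing Th P G.[y <- A] & y \notin domf G & x \notin domf G :
    typing Th (req x y P) G.[x <- WhyNot A]
| t_ofcourse P (G : ctx) x y A of
    typing [fmap] P G.[y <- A] & all_whynot G &
    y \notin domf G & x \notin domf G :
    typing [fmap] (srv x y P) G.[x <- OfCourse A]
| t_ex Th P (G : ctx) x A B of
    typing Th P G.[x <- inst_ty B A] & x \notin domf G :
    typing Th (outT x A P) G.[x <- Ex B]
| t_all Th P (G : ctx) x B of
    typing (shift_penv Th) P (shift_ctx G).[x <- B] & x \notin domf G :
    typing Th (inT x P) G.[x <- All B]
| t_weaken Th P (G : ctx) x A of
    typing Th P G & x \notin domf G :
    typing Th P G.[x <- WhyNot A]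
| t_contract Th P (G : ctx) x y z A of
    typing Th P G.[y <- WhyNot A].[z <- WhyNot A] &
    y \notin domf G & z \notin domf G & y != z & x \notin domf G :
    typing Th (rename_chan (fun w => if w \in [:: y; z] then x else w) P)
           G.[x <- WhyNot A]
| t_one x : typing [fmap] (close0 x) [fmap].[x <- One]
| t_bot Th P (G : ctx) x of
    typing Th P G & x \notin domf G :
    typing Th (wait x P) G.[x <- Bot]
| t_top Th (G : ctx) x of x \notin domf G :
    typing Th (case0 x) G.[x <- Top]
| t_id p (G : ptype) r (D : ctx) of renamed G r D :
    typing [fmap].[p <- G] (run p r) D
| t_chop Th Th' P Q (D : ptype) r (D' G : ctx) p of
    typing Th P D' & typing Th'.[p <- D] Q G & renamed D r D' &
    p \notin domf Th' & disj Th Th' & fn P = codomf r :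
    typing (Th + Th') (letin p r P Q) G
| t_send Th P (G : ptype) r (D : ctx) x of
    typing Th P D & renamed G r D & fn P = codomf r :
    typing Th (send x r P) [fmap].[x <- SendT G]
| t_recv Th P (G : ctx) x p (D : ptype) of
    typing Th.[p <- D] P G & p \notin domf Th & x \notin domf G :
    typing Th (recv x p P) G.[x <- RecvT D].

Fixpoint chop_free Th P G (d : typing Th P G) : bool :=
  match d with
  | t_axiom _ _ _ _ => true
  | t_cut _ _ _ _ _ _ _ _ _ d1 d2 _ _ _ _ => chop_free d1 && chop_free d2
  | t_tensor _ _ _ _ _ _ _ _ _ _ d1 d2 _ _ _ _ _ =>
      chop_free d1 && chop_free d2
  | t_par _ _ _ _ _ _ _ d1 _ _ _ => chop_free d1
  | t_plus1 _ _ _ _ _ _ d1 _ => chop_free d1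
  | t_plus2 _ _ _ _ _ _ d1 _ => chop_free d1
  | t_with _ _ _ _ _ _ _ d1 d2 _ => chop_free d1 && chop_free d2
  | t_whynot _ _ _ _ _ _ d1 _ _ => chop_free d1
  | t_ofcourse _ _ _ _ _ d1 _ _ _ => chop_free d1
  | t_ex _ _ _ _ _ _ d1 _ => chop_free d1
  | t_all _ _ _ _ _ d1 _ => chop_free d1
  | t_weaken _ _ _ _ _ d1 _ => chop_free d1
  | t_contract _ _ _ _ _ _ _ d1 _ _ _ _ => chop_free d1
  | t_one _ => true
  | t_bot _ _ _ _ d1 _ => chop_free d1
  | t_top _ _ _ _ => true
  | t_id _ _ _ _ _ => true
  | t_chop _ _ _ _ _ _ _ _ _ _ _ _ _ _ _ => false
  | t_send _ _ _ _ _ _ d1 _ _ => chop_free d1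
  | t_recv _ _ _ _ _ _ d1 _ _ => chop_free d1
  end.

(* Main.v *)
(* A chop is a cut on a higher-order channel: [let p = \r.P in Q] has the type of
   [(nu x y)(x[\r.P] | y(p).Q)] for fresh x and y, since send(D) and recv(D) are
   dual.  Replacing every chop in this way preserves not only the type but also
   the free channel names, on which the side condition of rule send depends. *)

Require Import Defs.
From mathcomp Require Import all_boot finmap.

Set Implicit Arguments.
Unset Strict Implicit.
Unset Printing Implicit Defensive.

Local Open Scope fset_scope.
Local Open Scope fmap_scope.

(** [fn] collects names by unions alone and never adjusts for binders, so the effect [g] of [fc] on
    a single reference, being the same at every depth [k], extends to whole processes by
    induction. *)
Lemma fn_traverse (g : {fset chan} -> {fset chan}) fc fv i j P :
    g fset0 = fset0 -> {morph g : A B / A `|` B} ->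
    (forall k c, fn_cref (fc k c) = g (fn_cref c)) ->
  fn (traverse fc fv i j P) = g (fn P).
Proof.
move=> g0 gU gfc; elim: P i j => /=; try by move=> *; rewrite ?gU ?gfc; congruence.
(* In the case of [RRun] the union ranges over a whole record, so [g] has to pass through an
   iterated union. *)
move=> v r i j; rewrite (big_morph g gU g0).
by apply: eq_bigr => l _; rewrite ffunE gfc.
Qed.

Lemma fn_close_chan b P :
  fn (close_chan b P) = [fset x in fn P | b x == None].
Proof.
apply: (fn_traverse (g := fun X => [fset x in X | b x == None])).
- by apply/fsetP=> x; rewrite !inE.
- by move=> A B; apply/fsetP=> x; rewrite !inE andb_orl.
move=> k [x|n s] /=; apply/fsetP=> z; last by rewrite !inE.
case bx: (b x) => [s|] /=; rewrite !inE /=; case: eqP => // ->; by rewrite bx.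
Qed.

Lemma fn_close1 y P : fn (close1 y P) = fn P `\ y.
Proof.
by rewrite fn_close_chan; apply/fsetP=> x; rewrite !inE andbC; case: (x == y).
Qed.

Lemma fn_par x A y P Q : fn (par x A y P Q) = (fn P `\ x) `|` (fn Q `\ y).
Proof. by rewrite -!fn_close1. Qed.

(** Which names get bound is decided by [r] alone, so a body may be replaced under an abstraction by
    any other with the same free names. *)
Lemma eq_fn_close_record r P Q :
  fn P = fn Q -> fn (close_record r P) = fn (close_record r Q).
Proof. by move=> e; rewrite !fn_close_chan e. Qed.

Lemma fn_close_pvar p P : fn (close_pvar p P) = fn P.
Proof. exact: (fn_traverse (g := id)). Qed.

Lemma fn_rename_chan f P : fn (rename_chan f P) = f @` fn P.
Proof.
apply: (fn_traverse (g := fun X => f @` X)); first exact: imfset0.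
  by move=> A B; rewrite imfsetU.
by move=> k [x|n s] /=; rewrite ?imfset_fset1 ?imfset0.
Qed.

Lemma ex_fresh (X : {fset chan}) : exists x, x \notin X.
Proof.
exists (\max_(y <- X) y).+1; apply/negP=> /(leq_bigmax_seq (F := id)).
by move=> /(_ xpredT isT); rewrite ltnn.
Qed.

Lemma chop_as_cut Th Th' P Q (D : ptype) (r : record) (D' G : ctx) (p : pvar)
    (dP : typing Th P D') (dQ : typing Th'.[p <- D] Q G) :
    chop_free dP -> chop_free dQ -> renamed D r D' -> p \notin domf Th' ->
    disj Th Th' -> fn P = codomf r ->
  exists R (d : typing (Th + Th') R G),
    chop_free d /\ fn R = fn (letin p r P Q).
Proof.
move=> cP cQ rD pTh' dTh fP.
(* The cut binds [x] and [y]. Freshness for the two bodies ensures that this removes no other free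
   name; [y] must also avoid [G] for rule [t_recv]. *)
have [x] := ex_fresh (fn (close_record r P)).
have [y] := ex_fresh (fn Q `|` domf G); rewrite inE => /norP[yQ yG] xP.
pose dx := t_send x dP rD fP; pose dy := t_recv dQ pTh' yG.
have x0 : x \notin domf ([fmap] : ctx) by rewrite inE.
have d0 : disj ([fmap] : ctx) G by exact: fdisjoint0X.
(* The sender contributes only [x], so the cut leaves the context [[fmap] + G]. Quantifying over the
   derivation lets [cat0f] rewrite this index to [G] without a transport of [d]. *)
have: exists d : typing (Th + Th') (par x (SendT D) y (send x r P) (recv y p Q))
                   ([fmap] + G), chop_free d.
  by exists (@t_cut _ _ _ _ _ _ _ _ (SendT D) dx dy x0 yG dTh d0) => /=; rewrite cP.
rewrite cat0f => -[d cd]; exists _, d; split=> //.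
by rewrite fn_par /= fn_close_pvar !fsetU1K.
Qed.

(** The equality of free names strengthens the induction hypothesis: an abstraction whose body has
    been transformed must still satisfy [fn P = codomf r]. *)
Lemma chop_elim Th P (G : ctx) :
  typing Th P G ->
  exists Q (d : typing Th Q G), chop_free d /\ fn Q = fn P.
Proof.
elim=> {Th P G}.
- by move=> x y A xy; exists _, (t_axiom A xy).
- move=> Th Th' P Q G D x y A _ [P' [dP [cP fP]]] _ [Q' [dQ [cQ fQ]]] h1 h2 h3 h4.
  exists _, (t_cut dP dQ h1 h2 h3 h4); split; first by rewrite /= cP.
  by rewrite !fn_par fP fQ.
- move=> Th Th' P Q G D x y A B _ [P' [dP [cP fP]]] _ [Q' [dQ [cQ fQ]]].
  move=> h1 h2 h3 h4 h5.
  exists _, (t_tensor dP dQ h1 h2 h3 h4 h5); split; first by rewrite /= cP.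
  by rewrite /= !fn_close1 fP fQ.
- move=> Th P G x y A B _ [P' [dP [cP fP]]] h1 h2 h3.
  by exists _, (t_par dP h1 h2 h3); rewrite /= !fn_close1 fP.
- move=> Th P G x A B _ [P' [dP [cP fP]]] h.
  by exists _, (t_plus1 B dP h); rewrite /= fP.
- move=> Th P G x A B _ [P' [dP [cP fP]]] h.
  by exists _, (t_plus2 A dP h); rewrite /= fP.
- move=> Th P Q G x A B _ [P' [dP [cP fP]]] _ [Q' [dQ [cQ fQ]]] h.
  by exists _, (t_with dP dQ h); rewrite /= cP fP fQ.
- move=> Th P G x y A _ [P' [dP [cP fP]]] h1 h2.
  by exists _, (t_whynot dP h1 h2); rewrite /= !fn_close1 fP.
- move=> P G x y A _ [P' [dP [cP fP]]] h1 h2 h3.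
  by exists _, (t_ofcourse dP h1 h2 h3); rewrite /= !fn_close1 fP.
- move=> Th P G x A B _ [P' [dP [cP fP]]] h.
  by exists _, (t_ex dP h); rewrite /= fP.
- move=> Th P G x B _ [P' [dP [cP fP]]] h.
  by exists _, (t_all dP h); rewrite /= fP.
- move=> Th P G x A _ [P' [dP [cP fP]]] h.
  by exists _, (t_weaken A dP h).
- move=> Th P G x y z A _ [P' [dP [cP fP]]] h1 h2 h3 h4.
  by exists _, (t_contract dP h1 h2 h3 h4); rewrite !fn_rename_chan fP.
- by move=> x; exists _, (t_one x).
- move=> Th P G x _ [P' [dP [cP fP]]] h.
  by exists _, (t_bot dP h); rewrite /= fP.
- by move=> Th G x h; exists _, (t_top Th h).
- by move=> p G r D h; exists _, (t_id p h).
- move=> Th Th' P Q D r D' G p _ [P' [dP [cP fP]]] _ [Q' [dQ [cQ fQ]]] h1 h2 h3 h4.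
  (* Both premises are already chop-free here, so a single replacement by a cut suffices. *)
  have [|R [d [cd fR]]] := chop_as_cut cP cQ h1 h2 h3; first by rewrite fP.
  exists R, d; split=> //.
  by rewrite fR /= !fn_close_pvar (eq_fn_close_record r fP) fQ.
- move=> Th P G r D x _ [P' [dP [cP fP]]] h1 h2.
  have fP' : fn P' = codomf r by rewrite fP.
  by exists _, (t_send x dP h1 fP'); rewrite /= (eq_fn_close_record r fP).
- move=> Th P G x p D _ [P' [dP [cP fP]]] h1 h2.
  by exists _, (t_recv dP h1 h2); rewrite /= !fn_close_pvar fP.
Qed.

Theorem theorem4p6 (Th : penv) (P : proc) (G : ctx) :
  typing Th P G ->
  exists (Q : proc) (d : typing Th Q G), chop_free d.
Proof. by case/chop_elim=> Q [d [cd _]]; exists Q, d. Qed.
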